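(* Let $G$ be a connected bipartite graph with at least one vertex of degree $1$. Then $G$ has exactly four distinct normalized Laplacian eigenvalues if and only if $G$ is the graph obtained from the disjoint union $G'\cup K_2$ by joining one vertex of $K_2$ to every vertex of one part (color class) of $G'$, where either $G'=K_2$, or $G'$ is the incidence graph of the complement of a Hadamard design (i.e. the incidence graph of a symmetric BIBD with parameters $(4t-1,2t,t)$ for some positive integer $t$).
   Context: A balanced incomplete block design (BIBD) is a pair $(V,\mathcal{B})$ where $V$ is a $v$-set and $\mathcal{B}$ is a collection of $b$ $k$-subsets (blocks) of $V$ such that each element lies in exactly $r$ blocks and each pair of distinct elements lies in exactly $\lambda$ blocks. It is symmetric with parameters $(v,k,\lambda)$ if $r=k$ (hence $b=v$). The complement of $(V,\mathcal{B})$ is $(V,\{V\setminus B: B\in\mathcal{B}\})$. A Hadamard design of dimension $t$ is a symmetric BIBD with parameters $(4t-1,2t-1,t-1)$; its complement is a symmetric BIBD with parameters $(4t-1,2t,t)$. The incidence graph of $(V,\mathcal{B})$ is the bipartite graph with vertex set $V\cup\mathcal{B}$ in which $x\in V$ and $B\in\mathcal{B}$ are adjacent iff $x\in B$. For a graph with adjacency matrix $A$ and diagonal degree matrix $D$ (no isolated vertices), the normalized Laplacian is $\mathcal{L}=I-D^{-1/2}AD^{-1/2}$, and its eigenvalues are the normalized Laplacian eigenvalues. *)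

(* Defs.v *)
From HB Require Import structures.
From mathcomp Require Import all_boot all_order all_algebra.
From mathcomp Require Import reals.
Set Implicit Arguments. Unset Strict Implicit. Unset Printing Implicit Defensive.
Import Order.TTheory GRing.Theory Num.Theory.
Local Open Scope ring_scope.

(* A finite simple graph is an edge relation e : rel T that is symmetric and
   irreflexive. *)

Definition deg (T : finType) (e : rel T) (x : T) : nat := #|[set y | e x y]|.

Definition connected_graph (T : finType) (e : rel T) : Prop :=
  forall x y : T, connect e x y.

Definition bipartite (T : finType) (e : rel T) : Prop :=
  exists c : T -> bool, forall x y, e x y -> c x != c y.

Definition adj_mx (R : ringType) (n : nat) (e : rel 'I_n) : 'M[R]_n :=
  \matrix_(i < n, j < n) (e i j)%:R.

Definition deg_invsqrt_mx (R : rcfType) (n : nat) (e : rel 'I_n) : 'M[R]_n :=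
  diag_mx (\row_(i < n) (Num.sqrt ((deg e i)%:R : R))^-1).

Definition norm_laplacian (R : rcfType) (n : nat) (e : rel 'I_n) : 'M[R]_n :=
  1%:M - deg_invsqrt_mx R e *m adj_mx R e *m deg_invsqrt_mx R e.

Definition num_distinct_eigenvalues_eq (R : fieldType) (n : nat)
    (M : 'M[R]_n) (k : nat) : Prop :=
  exists s : seq R, [/\ uniq s, size s = k & forall a : R, eigenvalue M a = (a \in s)].

Definition isomorphic (T U : finType) (e : rel T) (e' : rel U) : Prop :=
  exists f : T -> U, bijective f /\ forall x y, e x y = e' (f x) (f y).

(* The graph obtained from G' (edge relation e' on V') disjoint union K_2
   (vertices inr true, inr false) by joining the vertex inr true of K_2 to
   every vertex of the part P of G'. *)
Definition pendant_join (V : finType) (e' : rel V) (P : pred V) : rel (V + bool) :=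
  fun x y =>
    match x, y with
    | inl u, inl w => e' u w
    | inl u, inr true => P u
    | inr true, inl u => P u
    | inr true, inr false => true
    | inr false, inr true => true
    | _, _ => false
    end.

Definition K2 : rel bool := fun x y => x != y.

Definition sym_bibd (v k lam : nat) (blk : 'I_v -> {set 'I_v}) : Prop :=
  [/\ forall B, #|blk B| = k,
      forall x, #|[set B | x \in blk B]| = k
    & forall x y, x != y -> #|[set B | (x \in blk B) && (y \in blk B)]| = lam].

Definition incidence_graph (v b : nat) (blk : 'I_b -> {set 'I_v}) :
    rel ('I_v + 'I_b) :=
  fun x y =>
    match x, y with
    | inl p, inr B => p \in blk B
    | inr B, inl p => p \in blk B
    | _, _ => false
    end.

Definition is_inl (A B : Type) (x : A + B) : bool :=
  if x is inl _ then true else false.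

(* Main.v *)
Require Import Defs.
From HB Require Import structures.
From mathcomp Require Import all_boot all_order all_algebra.
From mathcomp Require Import reals.
From mathcomp Require Import complex ring lra zify.
Set Implicit Arguments. Unset Strict Implicit. Unset Printing Implicit Defensive.
Import Order.TTheory GRing.Theory Num.Theory.
Local Open Scope ring_scope.

(* Normalized Laplacian eigenvalues are [1 - mu] with [mu] an eigenvalue of the
   random walk operator [P].  In a connected bipartite graph the spectrum of [P]
   is symmetric, and the [P^2]-harmonic functions are those constant on each
   color class.  Since [P] is diagonalizable, four eigenvalues [1, -1, th, -th]
   mean that [P^2 - th^2] maps onto such functions, i.e. that for [x], [y] of the
   same color the sum of [1 / d z] over common neighbors [z] equals
   [th^2 d_x (x == y) + kap d_x d_y].  Applied to a leaf [x0] with neighbor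
   [y0], this forces [y0] to be adjacent to the whole color class of [x0], and
   then forces all degrees and all pairwise intersections in the rest of the
   graph: with [2 q] the degree of [y0], the rest is [q]-regular with [2 q - 1]
   vertices in each class and [q / 2] common neighbors per pair in a class.
   Conversely such graphs satisfy the identity; the two sides of the design
   play the same role because the dual of a symmetric design is a design. *)

(** * Diagonalization of real symmetric matrices *)

(** Over [R[i]] the matrix is Hermitian, hence unitarily diagonalizable with real diagonal; [p]
    kills every diagonal entry, and the vanishing descends to [R] because the embedding is
    injective. Multiplicities of roots do not matter. *)
Lemma symmetric_horner_mx_eq0 (R : rcfType) n (M : 'M[R]_n.+1) (p : {poly R}) :
  M^T = M -> (forall a, eigenvalue M a -> root p a) -> horner_mx M p = 0.
Proof.
move=> symM rootp; pose MC := map_mx (real_complex R) M.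
have hermM : MC \is hermsymmx.
  apply/is_hermitianmxP; rewrite expr0 scale1r; apply/matrixP=> i j.
  by rewrite !mxE -{1}symM mxE; apply/esym/CrealP/complex_realP; exists (M j i).
have /orthomx_spectralP specM := hermitian_normalmx hermM.
have Punit := spectral_unit MC.
apply: (@map_mx_inj _ _ (real_complex R)).
rewrite /= map_mx0 map_horner_mx -/MC specM horner_mx_uconjC //.
rewrite horner_mx_diag (_ : map_mx _ _ = 0) ?raddf0 ?mulmx0 ?mul0mx //.
apply/rowP=> j; rewrite !mxE.
have /mxOverP/(_ 0 j)/complex_realP[a da] := hermitian_spectral_diag_real hermM.
rewrite da horner_map /=; suff /rootP-> : root p a by rewrite rmorph0.
(* The characteristic polynomial carries eigenvalues of [M] over [R] to those of [MC]. Row [j] of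
   the diagonalizing matrix is then the eigenvector, nonzero by invertibility. *)
apply: rootp; rewrite eigenvalue_root_char -(fmorph_root (real_complex R)).
rewrite map_char_poly /= -eigenvalue_root_char -da.
apply/eigenvalueP; exists (row j (spectralmx MC)).
  rewrite -/MC -row_mul [X in _ *m X]specM !mulmxA mulmxV // mul1mx.
  by rewrite row_mul row_diag_mx -scalemxAl -rowE.
apply/eqP=> row0; have := row_free_unit (spectralmx MC).
rewrite Punit => /row_freeP[B PB].
have := congr1 (row j) PB; rewrite row_mul row0 mul0mx => /rowP/(_ j)/eqP.
by rewrite !mxE eqxx eq_sym oner_eq0.
Qed.

(** * The random walk operator and the normalized Laplacian *)

Definition walk_op (R : rcfType) (T : finType) (e : rel T) (f : T -> R) (x : T)
  : R := ((deg e x)%:R)^-1 * \sum_(y | e x y) f y.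

Definition walk_eigenvalue (R : rcfType) (T : finType) (e : rel T) (mu : R) :=
  exists2 f : T -> R, exists x, f x != 0 & walk_op e f =1 (fun x => mu * f x).

Lemma deg_neq0 (R : numDomainType) (T : finType) (e : rel T) x :
  (0 < deg e x)%N -> (deg e x)%:R != 0 :> R.
Proof. by rewrite pnatr_eq0 lt0n. Qed.

Lemma sqrt_deg_neq0 (R : rcfType) (T : finType) (e : rel T) x :
  (0 < deg e x)%N -> Num.sqrt (deg e x)%:R != 0 :> R.
Proof. by move=> dx; rewrite sqrtr_eq0 -ltNge ltr0n. Qed.

Lemma norm_adj_mxE (R : rcfType) n (e : rel 'I_n) i j :
  (1%:M - norm_laplacian R e) i j =
  (Num.sqrt (deg e i)%:R)^-1 * (e i j)%:R * (Num.sqrt (deg e j)%:R)^-1.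
Proof.
rewrite /norm_laplacian subKr /deg_invsqrt_mx mul_mx_diag mxE.
by rewrite mul_diag_mx !mxE.
Qed.

Lemma norm_adj_mx_sym (R : rcfType) n (e : rel 'I_n) :
  symmetric e -> (1%:M - norm_laplacian R e)^T = 1%:M - norm_laplacian R e.
Proof.
move=> syme; apply/matrixP=> i j; rewrite mxE !norm_adj_mxE syme.
by rewrite mulrC (mulrC _ (e i j)%:R) mulrA.
Qed.

(* Conjugation by D^(1/2) turns the normalized adjacency matrix into the
   transition operator of the simple random walk. *)
Definition sqrt_deg_col (R : rcfType) n (e : rel 'I_n) (f : 'I_n -> R)
  : 'cV[R]_n := \col_i (Num.sqrt (deg e i)%:R * f i).

Lemma mul_norm_adj_mx_col (R : rcfType) n (e : rel 'I_n) (f : 'I_n -> R) :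
  (forall x, (0 < deg e x)%N) ->
  (1%:M - norm_laplacian R e) *m sqrt_deg_col e f = sqrt_deg_col e (walk_op e f).
Proof.
move=> dpos; apply/colP=> i; rewrite mxE mxE /walk_op mulrA.
have -> : Num.sqrt (deg e i)%:R / (deg e i)%:R = (Num.sqrt (deg e i)%:R)^-1 :> R.
  rewrite -{2}[(deg e i)%:R]sqr_sqrtr ?ler0n // expr2 invfM mulrA.
  by rewrite mulfV ?mul1r // sqrt_deg_neq0.
rewrite [in RHS]big_mkcond mulr_sumr; apply: eq_bigr => j _.
rewrite norm_adj_mxE mxE -!mulrA mulKf ?sqrt_deg_neq0 //.
by case: (e i j); rewrite ?mul1r ?mul0r.
Qed.

Lemma sqrt_deg_col_inj (R : rcfType) n (e : rel 'I_n) (f g : 'I_n -> R) :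
  (forall x, (0 < deg e x)%N) -> sqrt_deg_col e f = sqrt_deg_col e g -> f =1 g.
Proof.
move=> dpos /colP eqfg x; have := eqfg x; rewrite !mxE.
exact/mulfI/sqrt_deg_neq0.
Qed.

(** [eigenvalue] speaks of row vectors; since the Laplacian is symmetric, transposition gives
    columns, where [D^(1/2) f] is an eigenvector for [a] exactly when [f] is a walk eigenfunction
    for [1 - a]. *)
Lemma eigenvalue_norm_laplacianE (R : rcfType) n (e : rel 'I_n) (a : R) :
  symmetric e -> (forall x, (0 < deg e x)%N) ->
  eigenvalue (norm_laplacian R e) a <-> walk_eigenvalue e (1 - a).
Proof.
move=> syme dpos; set L := norm_laplacian R e.
have LE : L = 1%:M - (1%:M - L) by rewrite subKr.
have symL : L^T = L by rewrite LE linearB /= trmx1 norm_adj_mx_sym.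
split.
  case/eigenvalueP=> v vL v0.
  pose f i := v 0 i / Num.sqrt (deg e i)%:R.
  have fE : sqrt_deg_col e f = v^T.
    by apply/colP=> i; rewrite !mxE mulrC divfK ?sqrt_deg_neq0.
  exists f.
    have /rV0Pn[i vi] := v0; exists i.
    by rewrite mulf_neq0 ?invr_eq0 ?sqrt_deg_neq0.
  apply: (sqrt_deg_col_inj dpos); rewrite -mul_norm_adj_mx_col // fE.
  rewrite mulmxBl mul1mx -/L -[L in L *m _]symL -trmx_mul vL linearZ /= -fE.
  by apply/colP=> i; rewrite !mxE; ring.
case=> f [x fx] Pf; apply/eigenvalueP; exists (sqrt_deg_col e f)^T.
  rewrite -[L in LHS]symL -trmx_mul LE mulmxBl mul1mx mul_norm_adj_mx_col //.
  by apply/rowP=> i; rewrite !mxE Pf; ring.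
apply/rV0Pn; exists x; rewrite !mxE mulf_neq0 ?sqrt_deg_neq0 //.
Qed.

(** Every eigenvalue is a root of [(X^2 - 1)(X^2 - th2)], so this polynomial annihilates the
    normalized adjacency matrix: the image of [P^2 - th2] lies in the kernel of [P^2 - 1]. *)
Lemma walk_op_annihilated (R : rcfType) n (e : rel 'I_n) (th2 : R) :
  symmetric e -> (forall x, (0 < deg e x)%N) ->
  (forall mu, walk_eigenvalue e mu -> mu ^+ 2 = 1 \/ mu ^+ 2 = th2) ->
  forall u, let g := fun x => walk_op e (walk_op e u) x - th2 * u x in
  walk_op e (walk_op e g) =1 g.
Proof.
(* [horner_mx] requires a nonzero dimension; without vertices the claim is vacuous. *)
case: n e => [|n] e syme dpos eig u g; first by case.
set M := 1%:M - norm_laplacian R e.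
have : horner_mx M (('X^2 - 1) * ('X^2 - th2%:P)) = 0.
  apply: symmetric_horner_mx_eq0; first exact: norm_adj_mx_sym.
  move=> mu /eigenvalueP[v vM v0]; rewrite /root !hornerE.
  have: walk_eigenvalue e mu.
    rewrite -[mu](subKr 1); apply/eigenvalue_norm_laplacianE => //.
    apply/eigenvalueP; exists v => //.
    have -> : norm_laplacian R e = 1%:M - M by rewrite subKr.
    by rewrite mulmxBr mulmx1 vM scalerBl scale1r.
  by case/eig=> ->; rewrite subrr ?mul0r ?mulr0.
rewrite rmorphM !rmorphB !rmorphXn /= horner_mx_X rmorph1 horner_mx_C => ann.
have colg : (M ^+ 2 - th2%:M) *m sqrt_deg_col e u = sqrt_deg_col e g.
  rewrite mulmxBl expr2 -mulmxA !mul_norm_adj_mx_col // mul_scalar_mx.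
  by apply/colP=> i; rewrite !mxE /g; ring.
have := congr1 (mulmx^~ (sqrt_deg_col e u)) ann.
rewrite mul0mx -mulmxE -mulmxA colg mulmxBl mul1mx expr2 -mulmxA.
rewrite !mul_norm_adj_mx_col // => /eqP; rewrite subr_eq0 => /eqP.
exact: sqrt_deg_col_inj.
Qed.

(** * Walks on properly two-colored graphs and the two-step identity *)

Section TwoColoredWalk.

Context (R : rcfType) (T : finType) (e : rel T) (c : T -> bool).
Hypothesis syme : symmetric e.
Hypothesis dpos : forall x, (0 < deg e x)%N.
Hypothesis proper : forall x y, e x y -> c x != c y.

Local Notation d x := ((deg e x)%:R : R).

Let dn0 x : d x != 0. Proof. exact: deg_neq0. Qed.

(** The two-step transition probability is [walk2 x y / d x]; without that factor the kernel is
    symmetric. *)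
Definition walk2 (x y : T) : R := \sum_(z | e x z && e z y) (d z)^-1.

(** Divided by [d x], this says that on each color class [P^2] is [th2] times the identity plus a
    rank-one operator with kernel [kap * d y]. *)
Definition two_step_identity (th2 kap : R) :=
  forall x y, c x = c y -> walk2 x y = th2 * d x * (x == y)%:R + kap * d x * d y.

Lemma degE x : d x = \sum_(y | e x y) 1.
Proof. by rewrite sumr_const /deg cardsE. Qed.

Lemma eq_walk_op (f g : T -> R) : f =1 g -> walk_op e f =1 walk_op e g.
Proof. by move=> eqfg x; rewrite /walk_op; congr (_ * _); apply: eq_bigr => y _. Qed.

Lemma walk_op_lin a (f g : T -> R) x :
  walk_op e (fun y => a * f y + g y) x = a * walk_op e f x + walk_op e g x.
Proof. by rewrite /walk_op big_split /= mulrDr -mulr_sumr mulrCA. Qed.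

Lemma walk_op_const (a : R) x : walk_op e (fun=> a) x = a.
Proof.
by rewrite /walk_op -[a]mulr1 -mulr_sumr -degE mulr1 mulrCA mulVf ?mulr1.
Qed.

Definition color_sign (x : T) : R := (-1) ^+ c x.

Lemma color_sign_neq0 x : color_sign x != 0.
Proof. by rewrite signr_eq0. Qed.

(** Neighbors carry opposite signs, so multiplication by the color sign anticommutes with [P]; this
    is the source of the symmetry of the spectrum. *)
Lemma walk_op_sign (f : T -> R) x :
  walk_op e (fun y => color_sign y * f y) x = - color_sign x * walk_op e f x.
Proof.
rewrite /walk_op [RHS]mulrCA; congr (_ * _); rewrite mulr_sumr.
apply: eq_bigr => y /proper.
by rewrite /color_sign; case: (c x); case: (c y) => //= _; rewrite ?opprK.
Qed.

Lemma walk_eigenvalueN (mu : R) : walk_eigenvalue e mu -> walk_eigenvalue e (- mu).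
Proof.
case=> f [x fx] Pf; exists (fun y => color_sign y * f y).
  by exists x; rewrite mulf_neq0 ?color_sign_neq0.
by move=> y; rewrite walk_op_sign Pf; ring.
Qed.

Lemma walk_eigenvalue1 (x : T) : walk_eigenvalue e (1 : R).
Proof.
exists (fun=> 1); first by exists x; rewrite oner_eq0.
by move=> y; rewrite walk_op_const mulr1.
Qed.

(** The degree measure is stationary: each [f y] is counted once per neighbor of [y]. *)
Lemma sum_walk_op (f : T -> R) : \sum_x d x * walk_op e f x = \sum_x d x * f x.
Proof.
rewrite (eq_bigr (fun x => \sum_(y | e x y) f y)); last first.
  by move=> x _; rewrite /walk_op mulVKf.
rewrite (exchange_big_dep xpredT) //=; apply: eq_bigr => y _.
rewrite (eq_bigl (fun x => e y x)) => [|x]; last exact: syme.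
by rewrite degE mulr_suml; apply: eq_bigr => x _; rewrite mul1r.
Qed.

(* The Dirichlet form of a harmonic function vanishes. *)
Lemma harmonic_const (f : T -> R) :
  connected_graph e -> walk_op e f =1 f -> forall x y, f x = f y.
Proof.
move=> conn Pf.
have energy : \sum_x \sum_(y | e x y) (f x - f y) ^+ 2 = 0.
  (* Expanding the square gives two square terms with equal totals, by stationarity, and a cross
     term that harmonicity turns into minus twice the same total. *)
  transitivity (\sum_x (d x * f x ^+ 2 + d x * walk_op e (fun y => f y ^+ 2) x
                        - 2 * (d x * (f x * walk_op e f x)))).
    apply: eq_bigr => x _; rewrite /walk_op [f x * _]mulrCA !mulVKf //.
    rewrite degE !mulr_suml !mulr_sumr -big_split -sumrB /=.
    by apply: eq_bigr => y _; ring.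
  rewrite sumrB big_split /= sum_walk_op -mulr_sumr.
  have -> : \sum_x d x * (f x * walk_op e f x) = \sum_x d x * f x ^+ 2.
    by apply: eq_bigr => x _; rewrite Pf expr2.
  by ring.
have edge x y : e x y -> f x = f y.
  move=> exy; apply/eqP; rewrite -subr_eq0 -sqrf_eq0.
  have := psumr_eq0P _ energy; move=> /(_ _ x isT).
  have sq_ge0 z : true -> 0 <= \sum_(y | e z y) (f z - f y) ^+ 2.
    by move=> _; apply: sumr_ge0 => *; apply: sqr_ge0.
  move/(_ sq_ge0) => /psumr_eq0P -> //= *; exact: sqr_ge0.
move=> x y; have /connectP[p] := conn x y.
elim: p x => [|z p IHp] x /=; first by move=> _ ->.
by case/andP=> /edge -> pz lastp; apply: IHp.
Qed.

(** [g + P g] is harmonic, and [g - P g] becomes harmonic once multiplied by the color sign. Both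
    are therefore constant on a color class, and so is their half-sum [g]. *)
Lemma sq_harmonic_color_const (g : T -> R) :
  connected_graph e -> walk_op e (walk_op e g) =1 g ->
  forall x y, c x = c y -> g x = g y.
Proof.
move=> conn PPg x y cxy.
have sumc : 1 * walk_op e g x + g x = 1 * walk_op e g y + g y.
  apply: (harmonic_const (f := fun z => 1 * walk_op e g z + g z)) => // z.
  by rewrite walk_op_lin PPg !mul1r addrC.
have diffc : color_sign x * ((-1) * walk_op e g x + g x)
           = color_sign y * ((-1) * walk_op e g y + g y).
  apply: (harmonic_const
    (f := fun z => color_sign z * ((-1) * walk_op e g z + g z))) => // z.
  by rewrite walk_op_sign walk_op_lin PPg; ring.
move: diffc; rewrite {1}/color_sign cxy => /(mulfI (color_sign_neq0 y)) diffc.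
lra.
Qed.

Lemma walk2_sym x y : walk2 x y = walk2 y x.
Proof. by apply: eq_bigl => z; rewrite andbC syme [e x z]syme. Qed.

Lemma walk2_eq0 x y : c x != c y -> walk2 x y = 0.
Proof.
move=> cxy; apply: big_pred0 => z; apply/negP=> /andP[/proper + /proper].
by move: cxy; case: (c x); case: (c y); case: (c z).
Qed.

Lemma walk_op2E (f : T -> R) x :
  walk_op e (walk_op e f) x =
  (d x)^-1 * \sum_(z | c z == c x) walk2 x z * f z.
Proof.
rewrite [in LHS]/walk_op; congr (_ * _).
transitivity (\sum_z walk2 x z * f z).
  rewrite (eq_bigr (fun y => \sum_(z | e y z) (d y)^-1 * f z)); last first.
    by move=> y _; rewrite mulr_sumr.
  rewrite (exchange_big_dep xpredT) //=; apply: eq_bigr => z _.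
  by rewrite mulr_suml.
rewrite [LHS](bigID (fun z => c z == c x)) /= [X in _ + X]big1 ?addr0 //.
by move=> z cz; rewrite walk2_eq0 ?mul0r // eq_sym.
Qed.

(** Every edge has one end of each color, so both sums count the edges. *)
Lemma sum_deg_color b : \sum_(x | c x == b) d x = \sum_(x | c x == ~~ b) d x.
Proof.
transitivity (\sum_(x | c x == b) \sum_(y | e x y) (1 : R)).
  by apply: eq_bigr => x _; rewrite degE.
rewrite (exchange_big_dep (fun y => c y == ~~ b)) /=; last first.
  by move=> x y /eqP<- /proper; case: (c x); case: (c y).
apply: eq_bigr => y /eqP cy; rewrite degE; apply: eq_bigl => x; rewrite syme.
apply: andb_idl => /proper; rewrite cy.
by case: (b); case: (c x).
Qed.

Lemma sum_deg_color_indep b b' :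
  \sum_(x | c x == b) d x = \sum_(x | c x == b') d x.
Proof.
by have [->//|] := eqVneq b b'; case: b; case: b' => // _; rewrite sum_deg_color.
Qed.

Lemma walk_op2_two_step th2 kap (f : T -> R) x : two_step_identity th2 kap ->
  walk_op e (walk_op e f) x
  = th2 * f x + kap * \sum_(z | c z == c x) d z * f z.
Proof.
move=> ts; rewrite walk_op2E.
rewrite (eq_bigr (fun z => d x * (th2 * ((x == z)%:R * f z)
                                  + kap * (d z * f z)))); last first.
  by move=> z /eqP cz; rewrite ts //; ring.
rewrite -mulr_sumr mulKf // big_split /= -!mulr_sumr; congr (_ * _ + _).
rewrite (bigD1 x) //= eqxx mul1r big1 ?addr0 // => z /andP[_].
by rewrite eq_sym => /negbTE->; rewrite mul0r.
Qed.

(** [P^2] fixes the constant function 1, which ties [kap] to [th2]. *)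
Lemma two_step_mass th2 kap b (x : T) : two_step_identity th2 kap ->
  kap * \sum_(z | c z == b) d z = 1 - th2.
Proof.
move=> ts; rewrite (sum_deg_color_indep b (c x)).
have := walk_op2_two_step (fun=> 1) x ts.
rewrite (eq_walk_op (walk_op_const 1)) walk_op_const.
rewrite (eq_bigr (fun z => d z)) => [|z _]; last by rewrite mulr1.
by move: (\sum_(z | _) _) => m massx; lra.
Qed.

(** On a color class [(mu^2 - th2) f] is the constant [kap * S], with [S] the weighted mass of [f].
    Summing against degrees gives [(mu^2 - th2) S = (1 - th2) S]; hence [S = 0] unless [mu^2 = 1],
    and then [mu^2 = th2] where [f] is nonzero. *)
Lemma two_step_eigenvalue_sqr (th2 kap mu : R) : two_step_identity th2 kap ->
  walk_eigenvalue e mu -> mu ^+ 2 = 1 \/ mu ^+ 2 = th2.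
Proof.
move=> ts [f [x fx] Pf]; have [->|mu1] := eqVneq (mu ^+ 2) 1; [by left|right].
have PPf y : (mu ^+ 2 - th2) * f y = kap * \sum_(z | c z == c y) d z * f z.
  have := walk_op2_two_step f y ts; rewrite (eq_walk_op Pf).
  have -> : walk_op e (fun z => mu * f z) y = mu * (mu * f y).
    by rewrite -Pf /walk_op -mulr_sumr mulrCA.
  by move=> eqm; rewrite mulrBl expr2 -mulrA eqm addrC addKr.
pose S := \sum_(z | c z == c x) d z * f z.
have S0 : S = 0.
  have mu1' : mu ^+ 2 - 1 != 0 by rewrite subr_eq0.
  apply: (mulfI mu1'); rewrite mulr0; have massx := two_step_mass (c x) x ts.
  suff eqS : (mu ^+ 2 - th2) * S = (1 - th2) * S by lra.
  rewrite -massx {1}/S mulrAC mulr_sumr [RHS]mulr_sumr.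
  by apply: eq_bigr => z /eqP cz; rewrite mulrCA PPf cz -/S; ring.
have := PPf x; rewrite -/S S0 mulr0 => /eqP; rewrite mulf_eq0 (negbTE fx) orbF.
by rewrite subr_eq0 => /eqP.
Qed.

(* For [f] with zero weighted mass on each color class, [th f + P f] is an
   eigenvector of the walk operator [P]. *)
Lemma two_step_eigenvalue (th kap : R) x y :
  two_step_identity (th ^+ 2) kap -> th != 0 -> x != y -> c x = c y ->
  walk_eigenvalue e th.
Proof.
move=> ts th0 xy cxy.
(* Two vertices of one color, weighted so that their masses cancel. As [P f] lives on the other
   color, [th f + P f] has the nonzero value [th * f x] at [x]. *)
pose f z := (z == x)%:R / d x - (z == y)%:R / d y.
have fsupp z : c z != c x -> f z = 0.
  move=> cz; rewrite /f; case: eqP => [eqz|_]; first by rewrite eqz eqxx in cz.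
  by case: eqP => [eqz|_]; [rewrite eqz cxy eqxx in cz | rewrite !mul0r subrr].
have mass0 b : \sum_(z | c z == b) d z * f z = 0.
  have [->|cb] := eqVneq b (c x); last first.
    by apply: big1 => z /eqP cz; rewrite fsupp ?mulr0 // cz.
  rewrite (bigD1 x) //= (bigD1 y) /=; last by rewrite cxy eqxx eq_sym.
  rewrite big1 ?addr0; last first.
    by move=> z /andP[/andP[_ /negbTE zx] /negbTE zy];
      rewrite /f zx zy !mul0r subrr mulr0.
  rewrite /f !eqxx (negbTE xy) eq_sym (negbTE xy) !mul0r subr0 sub0r !mul1r.
  by rewrite mulrN !mulfV // subrr.
exists (fun z => th * f z + walk_op e f z); last first.
  move=> z; rewrite walk_op_lin (walk_op2_two_step _ _ ts) mass0; ring.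
exists x; have -> : walk_op e f x = 0.
  rewrite /walk_op big1 ?mulr0 // => z /proper cz; apply: fsupp.
  by rewrite eq_sym.
rewrite addr0 mulf_neq0 // /f eqxx (negbTE xy) mul0r subr0 mul1r.
by rewrite invr_eq0.
Qed.

(** With [u] the indicator of [y], the kernel [G y] of [P^2 - th2] is constant on the class of [y].
    Its symmetry with respect to degrees and its total [1 - th2], obtained from the constant
    function, determine that constant. *)
Lemma annihilated_two_step (th2 : R) : connected_graph e ->
  (forall u, let g := fun x => walk_op e (walk_op e u) x - th2 * u x in
     walk_op e (walk_op e g) =1 g) ->
  forall x0 : T,
  two_step_identity th2 ((1 - th2) / \sum_(z | c z == c x0) d z).
Proof.
move=> conn ann x0 x y cxy.
pose G y z := walk2 z y / d z - th2 * (z == y)%:R.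
have Gconst y' z z' : c z = c z' -> c z = c y' -> G y' z = G y' z'.
  move=> czz' czy'; pose u w : R := (w == y')%:R.
  pose g w := walk_op e (walk_op e u) w - th2 * u w.
  have gE w : c w = c y' -> g w = G y' w.
    move=> cw; rewrite /g /G /u walk_op2E (bigD1 y') /= ?cw //.
    rewrite eqxx mulr1 big1 ?addr0 1?mulrC // => v /andP[_ /negbTE ->].
    by rewrite mulr0.
  rewrite -!gE -?czz' //; exact: sq_harmonic_color_const (ann u) _ _ czz'.
set m := \sum_(z | c z == _) d z; pose my := \sum_(z | c z == c y) d z.
have myE : m = my by apply: sum_deg_color_indep.
have my0 : my != 0.
  rewrite /my; apply/eqP=> my0; have /psumr_eq0P : my = 0 by [].
  by move=> /(_ (fun _ _ => ler0n _ _) y (eqxx _))/eqP; rewrite (negbTE (dn0 y)).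
have Gsym z : c z = c y -> d z * G y z = d y * G z y.
  move=> cz; rewrite /G !mulrBr !mulrA ![d _ * _ / d _]mulrAC !mulfV //.
  rewrite !mul1r walk2_sym eq_sym; case: eqP => [->|_] //.
  by rewrite !mulr0.
have Grow : \sum_(z | c z == c y) G z y = 1 - th2.
  rewrite sumrB; congr (_ - _).
    transitivity (walk_op e (walk_op e (fun=> 1 : R)) y); last first.
      by rewrite (eq_walk_op (walk_op_const 1)) walk_op_const.
    by rewrite walk_op2E mulr_sumr; apply: eq_bigr => z _; rewrite mulr1 mulrC.
  rewrite (bigD1 y) //= eqxx mulr1 big1 ?addr0 // => z /andP[_].
  by rewrite eq_sym => /negbTE ->; rewrite mulr0.
have GE : G y x = d y * (1 - th2) / my.
  apply: (mulIf my0); rewrite divfK // -Grow /my !mulr_sumr.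
  apply: eq_bigr => z /eqP cz.
  by rewrite -Gsym // mulrC; congr (_ * _); apply: Gconst; rewrite // cxy.
have : walk2 x y = d x * (G y x + th2 * (x == y)%:R).
  by rewrite /G subrK mulrC divfK.
by rewrite GE myE => ->; ring.
Qed.

End TwoColoredWalk.

(** * Four eigenvalues versus the two-step identity *)

(** The spectrum contains 0 and 2 and is stable under [a -> 2 - a], so the two other values are some
    [a] and [2 - a]; then [th = 1 - a]. *)
Lemma four_eigenvalues_two_step (R : rcfType) n (e : rel 'I_n)
    (c : 'I_n -> bool) (x0 : 'I_n) :
  symmetric e -> (forall x, (0 < deg e x)%N) ->
  (forall x y, e x y -> c x != c y) -> connected_graph e ->
  num_distinct_eigenvalues_eq (norm_laplacian R e) 4 ->
  exists th kap : R, [/\ th != 0, th ^+ 2 != 1, kap != 0,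
    walk_eigenvalue e th & two_step_identity e c (th ^+ 2) kap].
Proof.
move=> syme dpos proper conn [s [us sz4 eigs]].
have eigE mu : walk_eigenvalue e mu <-> 1 - mu \in s.
  by rewrite -eigs -{1}[mu](subKr 1); symmetry; apply: eigenvalue_norm_laplacianE.
have eig1 := walk_eigenvalue1 R dpos x0.
have in0 : 0 \in s by rewrite -(subrr 1); apply/eigE.
have in2 : 2 \in s.
  have -> : 2 = 1 - (-1) :> R by ring.
  by apply/eigE; apply: (walk_eigenvalueN proper).
have sub2 a : a \in s -> 2 - a \in s.
  move=> sa; have -> : 2 - a = 1 - (- (1 - a)) by ring.
  by apply/eigE/(walk_eigenvalueN proper)/eigE; rewrite subKr.
have [a [sa sE]] : exists a, [/\ a \in s, a != 0, a != 2, a != 1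
    & forall b, b \in s -> [|| b == 0, b == 2, b == a | b == 2 - a]].
  have ss : {subset rem 2 (rem 0 s) <= s}.
    by move=> b /mem_rem /mem_rem.
  have srem : perm_eq s [:: 0, 2 & rem 2 (rem 0 s)].
    apply: perm_trans (perm_to_rem in0) _; rewrite perm_cons.
    apply: perm_to_rem; rewrite mem_rem_uniq // inE in2 pnatr_eq0.
    by [].
  have := perm_uniq srem; rewrite us; have := perm_size srem; rewrite sz4.
  have := perm_mem srem; case: (rem 2 _) => [|a [|b []]] //= memE _.
  rewrite !inE !negb_or => /esym/and4P[/and3P[_ a0 b0] /andP[a2 b2] ab _].
  rewrite ![0 == _]eq_sym ![2 == _]eq_sym in a0 b0 a2 b2.
  have sa : a \in s by rewrite memE !inE eqxx !orbT.
  have sb : b \in s by rewrite memE !inE eqxx !orbT.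
  have a2' : 2 - a \in [:: a; b].
    have := sub2 _ sa; rewrite memE !inE => /or4P[||->|->]; rewrite ?orbT //.
      by rewrite subr_eq0 eq_sym (negbTE a2).
    by move=> /eqP aE; case/eqP: a0; lra.
  have b2' : 2 - b \in [:: a; b].
    have := sub2 _ sb; rewrite memE !inE => /or4P[||->|->]; rewrite ?orbT //.
      by rewrite subr_eq0 eq_sym (negbTE b2).
    by move=> /eqP bE; case/eqP: b0; lra.
  (* If the reflection fixed both [a] and [b], both would be 1, against distinctness; hence it swaps
     them. *)
  have abE : b = 2 - a.
    move: a2' b2'; rewrite !inE => /orP[/eqP aE|/eqP->//] /orP[]/eqP bE; first lra.
    by case/eqP: ab; lra.
  exists a; split=> //.
    by apply: contraNneq ab => a1; rewrite abE a1; apply/eqP; lra.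
  by move=> b'; rewrite memE !inE abE.
case: sE => a0 a2 a1 sE.
have th1 : (1 - a) ^+ 2 != 1.
  rewrite -subr_eq0 (_ : _ - 1 = a * (a - 2)); last by ring.
  by rewrite mulf_neq0 ?subr_eq0.
exists (1 - a), ((1 - (1 - a) ^+ 2) / \sum_(z | c z == c x0) (deg e z)%:R).
split=> //.
- by rewrite subr_eq0 eq_sym.
- apply: mulf_neq0; first by rewrite subr_eq0 eq_sym.
  rewrite invr_eq0; apply/eqP => m0.
  have /psumr_eq0P := m0; move=> /(_ (fun _ _ => ler0n _ _) x0 (eqxx _))/eqP.
  by rewrite pnatr_eq0 -leqn0 leqNgt dpos.
- by apply/eigE; rewrite subKr.
apply: annihilated_two_step => //; apply: walk_op_annihilated => // mu /eigE/sE.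
case/or4P=> /eqP muE.
- by left; rewrite (_ : mu = 1) ?expr1n //; lra.
- by left; rewrite (_ : mu = -1) ?sqrrN ?expr1n //; lra.
- by right; rewrite (_ : mu = 1 - a) //; lra.
- by right; rewrite (_ : mu = - (1 - a)) ?sqrrN //; lra.
Qed.

(** Squares of walk eigenvalues are 1 or [th2]. The value 1 comes from constants, [th] from the two
    vertices of equal color, and the negatives from symmetry. *)
Lemma two_step_four_eigenvalues (R : rcfType) n (e : rel 'I_n)
    (c : 'I_n -> bool) (th2 kap : R) x y :
  symmetric e -> (forall x, (0 < deg e x)%N) ->
  (forall x y, e x y -> c x != c y) ->
  two_step_identity e c th2 kap -> 0 < th2 -> th2 != 1 ->
  x != y -> c x = c y ->
  num_distinct_eigenvalues_eq (norm_laplacian R e) 4.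
Proof.
move=> syme dpos proper ts th2_gt0 th2_neq1 xy cxy.
pose th := Num.sqrt th2.
have thE : th ^+ 2 = th2 by rewrite sqr_sqrtr // ltW.
have th_gt0 : 0 < th by rewrite sqrtr_gt0.
have th1 : th != 1 by apply: contraNneq th2_neq1 => th1; rewrite -thE th1 expr1n.
rewrite -thE in ts.
exists [:: 0; 2; 1 - th; 1 + th]; split=> //.
  rewrite /= !inE !negb_or !andbT -!andbA.
  by apply/and5P; split; [| | | |apply/andP; split];
    apply/eqP; move: th1 => /eqP; lra.
move=> a; apply/idP/idP; rewrite !inE.
  move/(eigenvalue_norm_laplacianE _ syme dpos).
  move/(two_step_eigenvalue_sqr syme dpos proper ts).
  case=> /eqP; rewrite ?[_ == 1]sqrf_eq1 ?eqf_sqr => /orP[]/eqP aE; apply/or4P.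
  - by constructor 1; apply/eqP; lra.
  - by constructor 2; apply/eqP; lra.
  - by constructor 3; apply/eqP; lra.
  - by constructor 4; apply/eqP; lra.
have eig1 := walk_eigenvalue1 R dpos x.
have th0 : th != 0 by rewrite gt_eqF.
have eigth := two_step_eigenvalue dpos proper ts th0 xy cxy.
case/or4P=> /eqP->; apply/(eigenvalue_norm_laplacianE _ syme dpos).
- by rewrite subr0.
- by rewrite (_ : 1 - 2 = -1); [apply: (walk_eigenvalueN proper) | ring].
- by rewrite subKr.
- by rewrite opprD addNKr; apply: (walk_eigenvalueN proper).
Qed.

(** * The structure forced by a leaf *)

(** Here [x0] is the leaf, [y0] its neighbor (the hub), and [U], [W] are what remains of their
    respective color classes. The factor 2 in [ps_pair] avoids halving; for [q = 1] that field is
    vacuous, as [U] is then a single vertex. *)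
Record pendant_structure (T : finType) (e : rel T) (U W : {set T})
    (x0 y0 : T) (q : nat) : Prop := PendantStructure {
  ps_U : x0 \notin U; ps_W : y0 \notin W; ps_x0y0 : x0 != y0;
  ps_disj : [disjoint U & W]; ps_x0W : x0 \notin W; ps_y0U : y0 \notin U;
  ps_cover : forall x, [|| x \in U, x \in W, x == x0 | x == y0];
  ps_q : (0 < q)%N;
  ps_cardU : (#|U|.+1 = 2 * q)%N; ps_cardW : (#|W|.+1 = 2 * q)%N;
  ps_leaf : forall y, e x0 y = (y == y0);
  ps_hub : forall x, e y0 x = (x == x0) || (x \in U);
  ps_UU : forall x y, x \in U -> y \in U -> e x y = false;
  ps_WW : forall x y, x \in W -> y \in W -> e x y = false;
  ps_degU : forall x, x \in U -> #|[set z in W | e x z]| = q;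
  ps_degW : forall z, z \in W -> #|[set x in U | e x z]| = q;
  ps_pair : forall x y, x \in U -> y \in U -> x != y ->
    (2 * #|[set z in W | e x z && e y z]| = q)%N }.

Lemma two_step_pendant_structure (R : rcfType) (T : finType) (e : rel T)
    (c : T -> bool) (th kap : R) (x0 : T) :
  symmetric e -> (forall x, (0 < deg e x)%N) ->
  (forall x y, e x y -> c x != c y) ->
  th != 0 -> th ^+ 2 != 1 -> kap != 0 -> walk_eigenvalue e th ->
  two_step_identity e c (th ^+ 2) kap -> deg e x0 = 1%N ->
  exists U W y0 q, pendant_structure e U W x0 y0 q.
Proof.
move=> syme dpos proper th0 th21 kap0 eigth ts deg1.
pose d x : R := (deg e x)%:R.
have dn0 x : d x != 0 by apply: deg_neq0.
have [y0 leaf] : exists y0, forall y, e x0 y = (y == y0).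
  have /eqP/cards1P[y0 Ny0] := deg1; exists y0 => y.
  by have /setP/(_ y) := Ny0; rewrite !inE.
have ex0y0 : e x0 y0 by rewrite leaf.
have cy0 : c y0 = ~~ c x0.
  by have := proper _ _ ex0y0; case: (c x0); case: (c y0).
pose p := d y0.
(* Two-step walks from the leaf all pass through the hub. *)
have walk0 x : walk2 R e x0 x = (e y0 x)%:R / p.
  rewrite /walk2 (eq_bigl (fun z => (z == y0) && e z x)); last first.
    by move=> z; rewrite leaf.
  rewrite big_mkcondr big_pred1_eq.
  by case: ifP; rewrite ?mul1r ?mul0r.
have d0 : d x0 = 1 by rewrite /d deg1.
have invp : p^-1 = th ^+ 2 + kap.
  have := ts x0 x0 erefl; rewrite walk0 syme ex0y0 -!/(d _) d0 eqxx.
  by rewrite mul1r !mulr1.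
(* The identity at [(x0, x)] gives the nonzero value [kap * d x], so [x] must be adjacent to the
   hub; it also fixes the degree of [x]. *)
have sideU x : c x = c x0 -> x != x0 -> e y0 x /\ kap * p * d x = 1.
  move=> cx xx0; have := ts x0 x (esym cx).
  rewrite walk0 -!/(d _) d0 mulr1 eq_sym (negbTE xx0) mulr0 add0r mulr1.
  case: (e y0 x) => /= [|/eqP]; last first.
    by rewrite mul0r eq_sym mulf_eq0 (negbTE kap0) (negbTE (dn0 x)).
  by rewrite mul1r => kd; split=> //; rewrite mulrAC -kd mulVf ?dn0.
pose U := [set x | c x == c x0] :\ x0.
pose W := [set x | c x != c x0] :\ y0.
have inU x : x \in U = (x != x0) && (c x == c x0) by rewrite !inE.
have inW x : x \in W = (x != y0) && (c x != c x0) by rewrite !inE.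
(* Otherwise the graph is the single edge from [x0] to [y0], whose walk eigenvalues have square 1,
   against [th ^+ 2 != 1]. *)
have [x1 x1U] : exists x1, x1 \in U.
  case: (pickP (mem U)) => [x1 Ux1|U0]; first by exists x1.
  have colx0 x : c x = c x0 -> x = x0.
    move=> cx; apply/eqP; have := U0 x; rewrite inE /= inU cx eqxx andbT.
    by move/negbFE.
  have nbr y x : c y != c x0 -> e y x -> x = x0.
    move=> cy /proper cyx; apply: colx0.
    by move: cy cyx; case: (c y); case: (c x); case: (c x0).
  have coly0 y : c y != c x0 -> y = y0.
    move=> cy; have /card_gt0P[x] := dpos y; rewrite inE => eyx.
    by move: (eyx); rewrite (nbr _ _ cy eyx) syme leaf => /eqP.
  have hub1 y : e y0 y = (y == x0).
    apply/idP/eqP => [|->]; last by rewrite syme.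
    by apply: nbr; rewrite cy0; case: (c x0).
  have dy0 : d y0 = 1.
    rewrite /d /deg (_ : [set y | e y0 y] = [set x0]) ?cards1 //.
    by apply/setP=> y; rewrite !inE hub1.
  case: eigth => f [x fx] Pf.
  have := Pf x0; have := Pf y0; rewrite /walk_op -!/(d _) d0 dy0 invr1 !mul1r.
  rewrite (eq_bigl _ _ leaf) (eq_bigl _ _ hub1) !big_pred1_eq => fx0 fy0.
  have fx00 : f x0 = 0.
    apply/eqP; have : (th ^+ 2 - 1) * f x0 = 0.
      by rewrite mulrBl expr2 -mulrA -fy0 -fx0 mul1r subrr.
    by move/eqP; rewrite mulf_eq0 subr_eq0 (negbTE th21).
  case/eqP: fx; have [/colx0->//|/coly0->] := eqVneq (c x) (c x0).
  by rewrite fy0 fx00 mulr0.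
pose k := d x1.
have kapE : kap = (p * k)^-1.
  have /andP[x10 /eqP c1] : (x1 != x0) && (c x1 == c x0) by rewrite -inU.
  have [_ kE] := sideU _ c1 x10.
  by apply: (mulIf (mulf_neq0 (dn0 y0) (dn0 x1)));
    rewrite mulVf ?mulf_neq0 ?dn0 // mulrA.
have degU x : x \in U -> d x = k.
  rewrite inU => /andP[xx0 /eqP cx]; have [_ kE] := sideU _ cx xx0.
  apply: (mulfI (mulf_neq0 kap0 (dn0 y0))); rewrite kE kapE /k -/p; field.
  by rewrite (dn0 y0) (dn0 x1).
have p0 : p != 0 := dn0 y0.
have k0 : k != 0 := dn0 x1.
have th2E : th ^+ 2 = p^-1 - (p * k)^-1 by rewrite invp -kapE addrK.
have hub x : e y0 x = (x == x0) || (x \in U).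
  apply/idP/orP => [ey|[/eqP->|]].
  - have [->|xx0] := eqVneq x x0; [by left|right].
    have := proper _ _ ey; rewrite inU xx0 cy0 /=.
    by case: (c x); case: (c x0).
  - by rewrite syme.
  by rewrite inU => /andP[xx0 /eqP cx]; case: (sideU _ cx xx0).
have nbrW z x : z \in W -> e z x -> x \in U.
  rewrite inW inU => /andP[zy0 cz] ezx; apply/andP; split.
    by apply: contraNneq zy0 => xE; rewrite -leaf -xE syme.
  by have := proper _ _ ezx; move: cz; case: (c z); case: (c x); case: (c x0).
have nbrU x z : x \in U -> e x z -> (z == y0) || (z \in W).
  rewrite inU inW => /andP[_ /eqP cx] exz; case: eqP => //= _.
  by have := proper _ _ exz; rewrite cx eq_sym.
(* Neighbors of [z] lie in [U] and have degree [k], so the diagonal identity at [z] reads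
   [d z / k = d z * th^2 + kap * (d z)^2]. *)
have degW z : z \in W -> p = k - 1 + d z.
  move=> Wz; have := ts z z erefl; rewrite eqxx mulr1 -!/(d _) th2E kapE.
  have -> : walk2 R e z z = d z / k.
    rewrite /walk2 (eq_bigl (fun x => e z x)) => [|x]; last first.
      by rewrite [e x z]syme andbb.
    rewrite /d degE mulr_suml; apply: eq_bigr => x ezx.
    by rewrite mul1r -/(d x) degU // (nbrW z).
  move/(congr1 (fun t => t * (p * k) / d z)).
  have -> : d z / k * (p * k) / d z = p by field; rewrite dn0 k0.
  by move=> ->; field; rewrite dn0 k0.
have sum_nbrU (x y : T) (F : T -> R) : x \in U -> y \in U ->
    \sum_(z | e x z && e z y) F z =
    F y0 + \sum_(z in [set z in W | e x z && e y z]) F z.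
  move=> Ux Uy; rewrite (bigD1 y0) /=; last first.
    by rewrite syme hub Ux orbT hub Uy orbT.
  congr (_ + _); apply: eq_bigl => z; rewrite !inE [e z y]syme.
  case exz: (e x z); rewrite /= ?andbF //; have := nbrU _ _ Ux exz.
  rewrite inW; case: eqP => /= [_ _|_ ->]; rewrite ?andbF ?andbT //.
(* [k = 1] would give [th^2 = 0]. This makes [W] nonempty and allows division by [k - 1] below. *)
have k1 : k - 1 != 0.
  apply: contraNneq th0 => k1; rewrite -sqrf_eq0 th2E (_ : k = 1) ?mulr1 ?subrr //.
  by apply/eqP; rewrite -subr_eq0 k1.
have cardU x : x \in U -> d x = 1 + #|[set z in W | e x z]|%:R.
  move=> Ux; rewrite /d degE (eq_bigl (fun z => e x z && e z x)) => [|z]; last first.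
    by rewrite [e z x]syme andbb.
  rewrite sum_nbrU // sumr_const; congr (_ + _%:R).
  by apply: eq_card => z; rewrite !inE andbb.
have [z1 z1W] : exists z1, z1 \in W.
  have : #|[set z in W | e x1 z]| != 0%N.
    by apply: contraNneq k1 => Ne0; rewrite /k cardU // Ne0 addr0 subrr.
  by rewrite -lt0n => /card_gt0P[z]; rewrite inE => /andP[Wz _]; exists z.
pose q := deg e z1.
have q0 : d z1 != 0 := dn0 z1.
have dW z : z \in W -> d z = d z1.
  by move=> Wz; have := degW z Wz; rewrite (degW z1) // => /addrI.
have sum_invW (A : {set T}) : A \subset W ->
    \sum_(z in A) (d z)^-1 = #|A|%:R / d z1.
  move=> /subsetP AW; rewrite (eq_bigr (fun=> (d z1)^-1)) => [|z /AW/dW->//].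
  by rewrite sumr_const mulr_natl.
have walkU x y : x \in U -> y \in U ->
    walk2 R e x y = p^-1 + #|[set z in W | e x z && e y z]|%:R / d z1.
  move=> Ux Uy; rewrite /walk2 sum_nbrU // sum_invW //.
  by apply/subsetP=> z; rewrite inE => /andP[].
have cU x : x \in U -> c x = c x0 by rewrite inU => /andP[_ /eqP].
(* The diagonal identity at [x1] becomes [(k - 1) / d z1 = 2 (k - 1) / p] once the contribution
   [1 / p] of the hub is removed. *)
have pE : p = 2 * d z1.
  have := ts x1 x1 erefl; rewrite walkU // eqxx mulr1 -!/(d _) -/k th2E kapE.
  have -> : #|[set z in W | e x1 z && e x1 z]|%:R = k - 1.
    rewrite /k cardU // addrC addKr; congr (_%:R).
    by apply: eq_card => z; rewrite !inE andbb.
  move/(congr1 (fun t => (t - p^-1) * p * d z1 / (k - 1))).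
  have -> : (p^-1 + (k - 1) / d z1 - p^-1) * p * d z1 / (k - 1) = p.
    by field; rewrite k1 p0 q0.
  by move=> ->; field; rewrite k1 p0 k0.
have kE : k = d z1 + 1 by have := degW z1 z1W; rewrite pE; lra.
have natinj := @mulrIn R 1 (oner_neq0 R).
have degU' x : x \in U -> #|[set z in W | e x z]| = q.
  by move=> Ux; apply: natinj; have := cardU x Ux; rewrite degU // kE /q /d; lra.
have degW' z : z \in W -> #|[set x in U | e x z]| = q.
  move=> Wz; apply: natinj; rewrite -/(d z1) -(dW z) // /d /deg; congr (_%:R).
  apply: eq_card => x; rewrite !inE -inU syme andbC; apply: andb_idr.
  exact: nbrW.
have cardUq : (#|U|.+1 = 2 * q)%N.
  apply: natinj; rewrite natrM -/(d z1) -pE /p /d /deg; congr (_%:R).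
  rewrite (_ : [set y | e y0 y] = x0 |: U) ?cardsU1 ?inU ?eqxx //.
  by apply/setP=> y; rewrite inE hub !inE.
exists U, W, y0, q; split=> //.
- by rewrite inU eqxx.
- by rewrite inW eqxx.
- by apply: contraTneq ex0y0 => <-; apply/negP=> /proper; rewrite eqxx.
- by apply/pred0P=> x /=; rewrite inU inW; case: (c x == c x0); rewrite ?andbF.
- by rewrite inW eqxx andbF.
- by rewrite inU cy0; case: (c x0); rewrite andbF.
- by move=> x; rewrite inU inW; case: (c x == c x0); case: eqP; case: eqP.
- exact: dpos.
(* Edges between [U] and [W] are counted twice; [q]-regularity on both sides gives equal sizes. *)
- rewrite -cardUq; congr _.+1; apply/eqP.
  rewrite -(eqn_pmul2r (dpos z1)) -/q; apply/eqP.
  rewrite -!sum_nat_const -(eq_bigr _ degU') -(eq_bigr _ degW').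
  transitivity (\sum_(z in W) \sum_(x in U) e x z)%N.
    by apply: eq_bigr => z _; rewrite -sum1dep_card big_mkcondr.
  rewrite exchange_big; apply: eq_bigr => x _.
  by rewrite -sum1dep_card big_mkcondr.
- move=> x y /cU cx /cU cy; apply/negP=> /proper; by rewrite cx cy eqxx.
- move=> x y; rewrite !inW => /andP[_ cx] /andP[_ cy]; apply/negP=> /proper.
  by move: cx cy; case: (c x); case: (c y); case: (c x0).
(* For [N] common neighbors in [W], the off-diagonal identity is [1 / p + N / q = k / p], with
   [p = 2 q] and [k = q + 1]. *)
move=> x y Ux Uy xy; apply: natinj; rewrite natrM -/(d z1).
have := ts x y; rewrite !cU // => /(_ erefl).
rewrite walkU // (negbTE xy) mulr0 add0r -!/(d _) (degU x) // (degU y) // kapE.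
move/(congr1 (fun t => (t - p^-1) * p)).
set N := _%:R; have -> : (p^-1 + N / d z1 - p^-1) * p = 2 * N.
  by rewrite pE; field.
move=> ->; rewrite kE pE; field.
by rewrite -kE k0 q0.
Qed.

(** * Pendant structures as pendant joins, and dual designs *)

Lemma isomorphic_of_param (T V : finType) (e : rel T) (e' : rel V) (g : V -> T) :
  injective g -> (forall x, exists v, g v = x) ->
  (forall u w, e' u w = e (g u) (g w)) -> isomorphic e e'.
Proof.
move=> injg surjg ee'; have [f fK] := fin_all_exists surjg.
by exists f; split=> [|x y]; [exists g => //; exact: inj_can_sym | rewrite ee' !fK].
Qed.

Lemma set_param (T : finType) (A : {set T}) v : #|A| = v ->
  exists g : 'I_v -> T, injective g /\ forall x, (x \in A) <-> exists i, g i = x.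
Proof.
move=> <-; exists enum_val; split; first exact: enum_val_inj.
move=> x; split=> [Ax|[i <-]]; last exact: enum_valP.
by exists (enum_rank_in Ax x); rewrite enum_rankK_in.
Qed.

Lemma card_param (T I : finType) (A : {set T}) (g : I -> T) (Q : pred T) :
  injective g -> (forall x, (x \in A) <-> exists i, g i = x) ->
  #|[set i | Q (g i)]| = #|[set x in A | Q x]|.
Proof.
move=> injg imgA; rewrite -(card_imset _ injg); apply: eq_card => x.
rewrite inE; apply/imsetP/andP => [[j] | [/imgA[i <-] Qi]].
  by rewrite inE => Qj ->; split=> //; apply/imgA; exists j.
by exists i; rewrite // inE.
Qed.

Lemma pendant_structure_iso (T V : finType) (e : rel T) U W x0 y0 q
    (e' : rel V) (P : pred V) (h : V -> T) :
  symmetric e -> pendant_structure e U W x0 y0 q ->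
  injective h -> (forall x, (x \in U :|: W) <-> exists v, h v = x) ->
  (forall v, P v = (h v \in U)) -> (forall u w, e' u w = e (h u) (h w)) ->
  isomorphic e (pendant_join e' P).
Proof.
move=> syme ps injh imgh PU ee'.
pose g (v : V + bool) := match v with
  | inl u => h u | inr true => y0 | inr false => x0 end.
have hx0 u : h u != x0.
  apply/eqP => hu; have : x0 \in U :|: W by apply/imgh; exists u.
  by rewrite inE (negbTE (ps_U ps)) (negbTE (ps_x0W ps)).
have hy0 u : h u != y0.
  apply/eqP => hu; have : y0 \in U :|: W by apply/imgh; exists u.
  by rewrite inE (negbTE (ps_W ps)) (negbTE (ps_y0U ps)).
have x0y0 := ps_x0y0 ps.
apply: (@isomorphic_of_param _ _ _ _ g).
- move=> [u|[]] [w|[]] //=.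
  + by move/injh->.
  + by move/eqP; rewrite (negbTE (hy0 _)).
  + by move/eqP; rewrite (negbTE (hx0 _)).
  + by move/eqP; rewrite eq_sym (negbTE (hy0 _)).
  + by move/eqP; rewrite eq_sym (negbTE x0y0).
  + by move/eqP; rewrite eq_sym (negbTE (hx0 _)).
  + by move/eqP; rewrite (negbTE x0y0).
- move=> x; have /or4P[Ux|Wx|/eqP->|/eqP->] := ps_cover ps x.
  + by have /imgh[u <-] : x \in U :|: W by [rewrite inE Ux]; exists (inl u).
  + by have /imgh[u <-] : x \in U :|: W by [rewrite inE Wx orbT]; exists (inl u).
  + by exists (inr false).
  + by exists (inr true).
have hub := ps_hub ps; have leaf := ps_leaf ps.
have y0x0 := negbTE x0y0; rewrite eq_sym in y0x0.
move=> [u|[]] [w|[]] //=.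
- by rewrite syme hub (negbTE (hx0 _)) PU.
- by rewrite syme leaf (negbTE (hy0 _)).
- by rewrite hub (negbTE (hx0 _)) PU.
- by rewrite hub y0x0 (negbTE (ps_y0U ps)).
- by rewrite hub eqxx.
- by rewrite leaf (negbTE (hy0 _)).
- by rewrite leaf eqxx.
- by rewrite leaf (negbTE x0y0).
Qed.

(** For [q = 1] both [U] and [W] are singletons, which gives [K2]. For [q > 1], [U] contains a pair
    of vertices; half-integrality is excluded by [ps_pair], so [q = 2 t] and both sides have
    [2 q - 1 = 4 t - 1] elements. *)
Lemma pendant_structure_classify (T : finType) (e : rel T) U W x0 y0 q :
  symmetric e -> pendant_structure e U W x0 y0 q ->
  isomorphic e (pendant_join K2 (pred1 true)) \/
  exists t, (0 < t)%N /\ exists blk : 'I_(4 * t - 1) -> {set 'I_(4 * t - 1)},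
    sym_bibd (2 * t) t blk /\
    isomorphic e (pendant_join (incidence_graph blk) (@is_inl _ _)).
Proof.
move=> syme ps; have q0 := ps_q ps.
have cU := ps_cardU ps; have cW := ps_cardW ps.
have [q1|q2] : q = 1%N \/ (1 < q)%N by lia.
  left; subst q.
  have /eqP/cards1P[u UE] : #|U| = 1%N by lia.
  have /eqP/cards1P[w WE] : #|W| = 1%N by lia.
  have uw : u != w.
    have /pred0P/(_ u) := ps_disj ps; rewrite /= UE WE !inE eqxx /=.
    by move/negbT.
  have uU : u \in U by rewrite UE inE.
  have wW : w \in W by rewrite WE inE.
  have euw : e u w.
    have : #|[set z in W | e u z]| != 0%N by rewrite (ps_degU ps).
    rewrite -lt0n => /card_gt0P[z]; rewrite inE WE inE.
    by case/andP=> /eqP->.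
  apply: (@pendant_structure_iso _ _ _ U W x0 y0 1 _ _
            (fun b => if b then u else w)) => //.
  - move=> [] [] //= /eqP; first by rewrite (negbTE uw).
    by rewrite eq_sym (negbTE uw).
  - move=> x; rewrite UE WE !inE; split=> [/orP[]/eqP-> | [[] <-]].
    + by exists true.
    + by exists false.
    + by rewrite eqxx.
    + by rewrite eqxx orbT.
  - by case; rewrite UE inE ?eqxx // eq_sym (negbTE uw).
  - case; case; rewrite /K2 /=.
    + by rewrite (ps_UU ps).
    + by rewrite euw.
    + by rewrite syme euw.
    + by rewrite (ps_WW ps).
right.
have [x1 [x2 [x1U x2U x12]]] : exists x1 x2, [/\ x1 \in U, x2 \in U & x1 != x2].
  have : (1 < #|U|)%N by lia.
  by case/card_gt1P=> x1 [x2] [? ? ?]; exists x1, x2.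
pose t := #|[set z in W | e x1 z && e x2 z]|.
have qt : (2 * t)%N = q := ps_pair ps x1U x2U x12.
have vU : #|U| = (4 * t - 1)%N by lia.
have vW : #|W| = (4 * t - 1)%N by lia.
have [gU [injU imgU]] := set_param vU.
have [gW [injW imgW]] := set_param vW.
have gUU i : gU i \in U by apply/imgU; exists i.
have gWW i : gW i \in W by apply/imgW; exists i.
have disj x : x \in U -> x \in W -> False.
  by move=> Ux Wx; have /pred0P/(_ x) := ps_disj ps; rewrite /= Ux Wx.
exists t; split; first by lia.
(* Points are the vertices of [U]; the blocks are the neighborhoods in [U] of the vertices of
   [W]. *)
exists (fun j => [set i | e (gU i) (gW j)]); split.
  split=> [j|i|i i' ii'].
  - by rewrite (card_param (fun x => e x (gW j)) injU imgU) (ps_degW ps).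
  - transitivity #|[set j | e (gU i) (gW j)]|.
      by apply: eq_card => j; rewrite !inE.
    by rewrite (card_param (fun z => e (gU i) z) injW imgW) (ps_degU ps).
  transitivity #|[set j | e (gU i) (gW j) && e (gU i') (gW j)]|.
    by apply: eq_card => j; rewrite !inE.
  rewrite (card_param (fun z => e (gU i) z && e (gU i') z) injW imgW).
  have gii' : gU i != gU i' by apply: contraNneq ii' => /injU->.
  by have := ps_pair ps (gUU i) (gUU i') gii'; lia.
apply: (@pendant_structure_iso _ _ _ U W x0 y0 q _ _
  (fun v : 'I__ + 'I__ => match v with inl i => gU i | inr j => gW j end)) => //.
- move=> [i|j] [i'|j'].
  + by move/injU->.
  + by move=> gij; case: (disj (gU i)) => //; rewrite gij.
  + by move=> gij; case: (disj (gW j)) => //; rewrite gij.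
  + by move/injW->.
- move=> x; rewrite inE; split=> [/orP[/imgU[i <-]|/imgW[j <-]] | [[i|j] <-]].
  + by exists (inl i).
  + by exists (inr j).
  + by rewrite gUU.
  + by rewrite gWW orbT.
- case=> [i|j] /=; first by rewrite gUU.
  by apply/esym/negP => gU'; exact: disj (gWW j).
- case=> [i|j] [i'|j'] /=.
  + by rewrite (ps_UU ps).
  + by rewrite inE.
  + by rewrite inE syme.
  + by rewrite (ps_WW ps).
Qed.

(* With [J] the all-ones matrix, [N *m (N^T - J / 2) = t%:M]; a right inverse
   of a square matrix is a left inverse, and this is the dual identity. *)
Lemma hadamard_dual t (blk : 'I_(4 * t - 1) -> {set 'I_(4 * t - 1)}) :
  (0 < t)%N -> sym_bibd (2 * t) t blk ->
  forall B B', B != B' ->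
    #|[set x | (x \in blk B) && (x \in blk B')]| = t.
Proof.
move=> t0 [blkk ptk pair]; set v := (4 * t - 1)%N in blk blkk ptk pair *.
pose N : 'M[rat]_v := \matrix_(x, B) (x \in blk B)%:R.
have tn0 : t%:R != 0 :> rat by rewrite pnatr_eq0 -lt0n.
have NNT : N *m (N^T - const_mx 2^-1) = t%:R%:M.
  apply/matrixP=> x y; rewrite mulmxBr mxE [X in _ + X]mxE ![(_ *m _) _ _]mxE.
  have -> : \sum_B N x B * N^T B y
      = #|[set B | (x \in blk B) && (y \in blk B)]|%:R.
    rewrite -sum1dep_card natr_sum [RHS]big_mkcond; apply: eq_bigr => B _.
    by rewrite !mxE; case: (x \in _); case: (y \in _); rewrite ?mulr1 ?mul0r.
  have -> : \sum_B N x B * (const_mx 2^-1 : 'M[rat]_v) B y = t%:R.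
    transitivity (\sum_B N x B / 2); first by apply: eq_bigr => B _; rewrite !mxE.
    rewrite -mulr_suml.
    have -> : \sum_B N x B = (2 * t)%:R.
      rewrite -(ptk x) -sum1dep_card natr_sum [RHS]big_mkcond.
      by apply: eq_bigr => B _; rewrite mxE; case: (x \in _).
    by rewrite natrM; field.
  rewrite mxE; have [<-|xy] := eqVneq x y; last by rewrite pair // subrr.
  rewrite mulr1n (_ : [set B | _ && _] = [set B | x \in blk B]) ?ptk.
    by rewrite natrM; ring.
  by apply/setP=> B; rewrite !inE andbb.
have NTN : (N^T - const_mx 2^-1) *m N = t%:R%:M.
  have NV : N *m (t%:R^-1 *: (N^T - const_mx 2^-1)) = 1%:M.
    by rewrite -scalemxAr NNT scale_scalar_mx mulVf.
  have /(congr1 (fun A => t%:R *: A)) := mulmx1C NV.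
  by rewrite -scalemxAl scalerA mulfV // scale1r scale_scalar_mx mulr1.
move=> B B' BB'; have /matrixP/(_ B B') := NTN; rewrite mulmxBl mxE.
rewrite [X in _ + X]mxE ![(_ *m _) _ _]mxE.
have -> : \sum_x N^T B x * N x B'
    = #|[set x | (x \in blk B) && (x \in blk B')]|%:R.
  rewrite -sum1dep_card natr_sum [RHS]big_mkcond; apply: eq_bigr => x _.
  by rewrite !mxE; case: (x \in _); case: (x \in _); rewrite ?mulr1 ?mul0r.
have -> : \sum_x (const_mx 2^-1 : 'M[rat]_v) B x * N x B' = t%:R.
  transitivity (\sum_x 2^-1 * N x B'); first by apply: eq_bigr => x _; rewrite !mxE.
  rewrite -mulr_sumr.
  have -> : \sum_x N x B' = (2 * t)%:R.
    rewrite -(blkk B') -sum1_card natr_sum [RHS]big_mkcond.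
    by apply: eq_bigr => x _; rewrite mxE; case: (x \in _).
  by rewrite natrM; field.
rewrite mxE (negbTE BB') mulr0n => /eqP; rewrite subr_eq0 eqr_nat.
by move/eqP.
Qed.

(** * The two-step identity for pendant joins *)

(** The leaf [inr false] shares the color of [P]; the hub [inr true] has the opposite one. *)
Definition join_color (V : finType) (P : pred V) (x : V + bool) : bool :=
  match x with inl u => P u | inr b => ~~ b end.

Lemma pendant_join_proper (V : finType) (e : rel V) (P : pred V) :
  (forall u w, e u w -> P u != P w) -> forall x y,
  pendant_join e P x y -> join_color P x != join_color P y.
Proof. by move=> prop [u|[]] [w|[]] //=; [exact: prop|move->..]. Qed.

Lemma big_join (R : nmodType) (V : finType) (Q : pred (V + bool))
    (F : V + bool -> R) :
  \sum_(z | Q z) F z = \sum_(u | Q (inl u)) F (inl u)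
    + ((if Q (inr true) then F (inr true) else 0)
       + (if Q (inr false) then F (inr false) else 0)).
Proof.
by rewrite big_sumType /=; congr (_ + _); rewrite big_mkcond big_bool.
Qed.

Section PendantJoin.

Context (R : rcfType) (V : finType) (e : rel V) (P : pred V) (q : nat).
Hypothesis syme : symmetric e.
Hypothesis proper : forall u w, e u w -> P u != P w.
Hypothesis q_gt0 : (0 < q)%N.
Hypothesis regular : forall u, deg e u = q.
Hypothesis cardP : (#|P|.+1 = 2 * q)%N.
Hypothesis pair : forall u w, u != w -> P u = P w ->
  (2 * #|[set z | e u z && e w z]| = q)%N.

Local Notation J := (pendant_join e P).

Lemma deg_join_inl u : (deg J (inl u))%:R = q%:R + (P u)%:R :> R.
Proof.
rewrite degE big_join /= -degE regular addr0.
by case: (P u).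
Qed.

Lemma deg_join_hub : (deg J (inr true))%:R = 2 * q%:R :> R.
Proof.
rewrite degE big_join /= sumr_const add0r -natrM -cardP.
by rewrite -natr1.
Qed.

Lemma deg_join_leaf : (deg J (inr false))%:R = 1 :> R.
Proof. by rewrite degE big_join /= big_pred0 // add0r addr0. Qed.

(** With hub degree [p = 2 q] and degree [k = q + 1] on [P], the constants are [1/p - 1/(p k)] and
    [1/(p k)], as forced in the other direction. Pair counts enter for both color classes. *)
Lemma pendant_join_two_step :
  two_step_identity J (join_color P)
    ((2 * (q%:R + 1))^-1 : R) ((2 * q%:R * (q%:R + 1))^-1).
Proof.
have Q0 : q%:R != 0 :> R by rewrite pnatr_eq0 -lt0n.
have Q1 : q%:R + 1 != 0 :> R by rewrite natr1 pnatr_eq0.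
have N2 : 2 != 0 :> R by rewrite pnatr_eq0.
have nbr u w : e u w -> P w = ~~ P u by move/proper; case: (P u); case: (P w).
have common u w : P u = P w ->
    #|[set z | e u z && e w z]|%:R = q%:R * (1 + (u == w)%:R) / 2 :> R.
  have [<-|uw] := eqVneq u w; last first.
    move=> /(pair uw)/(congr1 (fun k : nat => k%:R : R)); rewrite natrM => <-.
    by rewrite mulr0n; field.
  move=> _; have -> : #|[set z | e u z && e u z]| = q.
    by rewrite -(regular u); apply: eq_card => z; rewrite !inE andbb.
  by rewrite mulr1n; field.
(* All common neighbors have the color opposite to [u], hence the same degree in the join. *)
have inner u w : P u = P w ->
    \sum_(z | e u z && e z w) (deg J (inl z))%:R^-1
    = q%:R * (1 + (u == w)%:R) / 2 / (q%:R + (~~ P u)%:R) :> R.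
  move=> Puw; rewrite -(common u w) //.
  rewrite (eq_bigr (fun=> (q%:R + (~~ P u)%:R)^-1)) => [|z /andP[euz _]]; last first.
    by rewrite deg_join_inl (nbr u z).
  rewrite sumr_const mulr_natl; congr (_ *+ _).
  by apply: eq_card => z; rewrite !inE [e w z]syme.
have outer u : P u = false ->
    \sum_(z | e u z) (deg J (inl z))%:R^-1 = q%:R / (q%:R + 1) :> R.
  move=> Pu; rewrite (eq_bigl (fun z => e u z && e z u)) => [|z]; last first.
    by rewrite [e z u]syme andbb.
  by rewrite inner // eqxx Pu mulr1n; field; rewrite Q1.
move=> [u|[]] [w|[]] //=; rewrite /walk2 big_join /= ?deg_join_inl
  ?deg_join_hub ?deg_join_leaf ?andbT ?andbF.
- move=> Puw; rewrite inner // -Puw !addr0 andbb (inj_eq inl_inj).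
  case: (P u); rewrite /= ?deg_join_hub ?addr0; case: (u == w);
    by rewrite /=; field; rewrite ?Q0 ?Q1.
- move=> Pu; rewrite (eq_bigl (fun z => e u z)) => [|z]; last first.
    by apply: andb_idr => /nbr ->; rewrite Pu.
  by rewrite outer // Pu mulr0n; field; rewrite Q0 Q1.
- move=> Pu; rewrite big_pred0 => [|z]; last by rewrite andbF.
  by rewrite Pu mulr1n; field; rewrite Q0 Q1.
- move=> /esym Pw; rewrite (eq_bigl (fun z => e w z)) => [|z]; last first.
    by rewrite [e z w]syme andbC; apply: andb_idr => /nbr ->; rewrite Pw.
  by rewrite outer // Pw mulr0n; field; rewrite Q0 Q1.
(* Diagonal entry at the hub: [2 q - 1] neighbors of degree [q + 1], and the leaf of degree 1. *)
- move=> _; rewrite (eq_bigr (fun=> (q%:R + 1)^-1)) => [|z /andP[Pz _]]; last first.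
    by rewrite deg_join_inl Pz.
  rewrite sumr_const (eq_card (B := P)) => [|z]; last by rewrite unfold_in /= andbb.
  have -> : (q%:R + 1)^-1 *+ #|P| = (2 * q%:R - 1) / (q%:R + 1) :> R.
    by rewrite -natrM -cardP -natr1 addrK mulr_natl.
  by field; rewrite Q0 Q1.
- move=> /esym Pw; rewrite big_pred0_eq.
  by rewrite Pw mulr1n; field; rewrite Q0 Q1.
- by rewrite big_pred0_eq => _; field; rewrite Q0 Q1.
Qed.

End PendantJoin.

(** * Transport along isomorphisms and the final equivalence *)

Lemma iso_deg (T V : finType) (e : rel T) (e' : rel V) (f : T -> V) :
  bijective f -> (forall x y, e x y = e' (f x) (f y)) ->
  forall x, deg e x = deg e' (f x).
Proof.
move=> bijf ee' x; rewrite /deg -(on_card_preimset (f := f)); last first.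
  exact: onW_bij.
by apply: eq_card => y; rewrite !inE.
Qed.

Lemma iso_two_step (R : rcfType) (T V : finType) (e : rel T) (e' : rel V)
    (f : T -> V) (c : V -> bool) (th2 kap : R) :
  bijective f -> (forall x y, e x y = e' (f x) (f y)) ->
  two_step_identity e' c th2 kap -> two_step_identity e (c \o f) th2 kap.
Proof.
move=> bijf ee' ts x y cxy; rewrite !(iso_deg bijf ee').
rewrite -(bij_eq bijf) -ts // /walk2 [RHS](reindex f) /=; last exact: onW_bij.
by apply: eq_big => [z|z _]; rewrite ?ee' ?(iso_deg bijf ee').
Qed.

Lemma pendant_join_four_eigenvalues (R : rcfType) n (e : rel 'I_n)
    (V : finType) (e' : rel V) (P : pred V) q :
  symmetric e -> (forall x, (0 < deg e x)%N) ->
  symmetric e' -> (forall u w, e' u w -> P u != P w) -> (0 < q)%N ->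
  (forall u, deg e' u = q) -> (#|P|.+1 = 2 * q)%N ->
  (forall u w, u != w -> P u = P w -> (2 * #|[set z | e' u z && e' w z]| = q)%N) ->
  isomorphic e (pendant_join e' P) ->
  num_distinct_eigenvalues_eq (norm_laplacian R e) 4.
Proof.
move=> syme dpos syme' proper q0 reg cardP pair [f [bijf ee']].
have ts := iso_two_step bijf ee'
  (pendant_join_two_step R syme' proper q0 reg cardP pair).
have [u Pu] : exists u, P u.
  have /card_gt0P[u Pu] : (0 < #|P|)%N by lia.
  by exists u.
have [g fK gK] := bijf.
have Q1 : 1 < 2 * (q%:R + 1) :> R.
  by have : 0 <= q%:R :> R := ler0n _ _; lra.
(* A vertex of [P] and the leaf are the two required vertices of equal color; [Q1] places [th2]
   strictly between 0 and 1. *)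
apply: (two_step_four_eigenvalues (x := g (inl u)) (y := g (inr false)) _ _ _ ts).
- by [].
- by [].
- by move=> x y; rewrite ee' /=; apply: pendant_join_proper.
- by rewrite invr_gt0; lra.
- by rewrite invr_eq1 gt_eqF.
- by rewrite (can_eq gK).
- by rewrite /= !gK /= Pu.
Qed.

Lemma card_sumset (A B : finType) (Q : pred (A + B)) :
  #|[set z | Q z]| = (#|[set a | Q (inl a)]| + #|[set b | Q (inr b)]|)%N.
Proof. by rewrite -!sum1dep_card big_sumType. Qed.

Lemma cards_true (A : finType) : #|[set _ : A | true]| = #|A|.
Proof. by rewrite -cardsT; apply: eq_card => a; rewrite !inE. Qed.

Lemma cards_false (A : finType) : #|[set _ : A | false]| = 0%N.
Proof. by apply: eq_card0 => a; rewrite inE. Qed.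

(** A path from [x] to the leaf starts with an edge at [x]. *)
Lemma connected_deg_gt0 (T : finType) (e : rel T) :
  connected_graph e -> (exists x, deg e x = 1%N) -> forall x, (0 < deg e x)%N.
Proof.
move=> conn [x0 deg1] x; have [->|xx0] := eqVneq x x0; first by rewrite deg1.
have /connectP[[|y p] /= path_p last_p] := conn x x0.
  by rewrite last_p eqxx in xx0.
by case/andP: path_p => exy _; apply/card_gt0P; exists y; rewrite inE.
Qed.

Theorem theorem3p1 (R : realType) (n : nat) (e : rel 'I_n) :
  symmetric e -> irreflexive e ->
  connected_graph e -> bipartite e ->
  (exists x : 'I_n, deg e x = 1%N) ->
  (num_distinct_eigenvalues_eq (norm_laplacian R e) 4 <->
   ((exists b : bool, isomorphic e (pendant_join K2 (pred1 b)))
    \/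
    (exists t : nat, (0 < t)%N /\
       exists blk : 'I_(4 * t - 1) -> {set 'I_(4 * t - 1)},
         sym_bibd (2 * t) t blk /\
         exists side : bool,
           isomorphic e (pendant_join (incidence_graph blk)
                          (fun x => if side then is_inl x else ~~ is_inl x))))).
Proof.
move=> syme _ conn [c proper] leaf.
have dpos := connected_deg_gt0 conn leaf.
split.
  case: leaf => x0 deg1.
  case/(four_eigenvalues_two_step x0 syme dpos proper conn) => th [kap].
  case=> th0 th1 kap0 eigth ts.
  have [U [W [y0 [q ps]]]] := two_step_pendant_structure syme dpos proper
    th0 th1 kap0 eigth ts deg1.
  have [isoK2|[t [t0 [blk [bibd iso]]]]] := pendant_structure_classify syme ps.
    by left; exists true.
  by right; exists t; split=> //; exists blk; split=> //; exists true.
case=> [[b]|[t [t0 [blk [bibd [side]]]]]].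
  apply: (@pendant_join_four_eigenvalues R n e bool _ _ 1) => //.
  - by move=> u w; rewrite /K2 eq_sym.
  - by move=> u w; rewrite /K2 /=; case: b; case: u; case: w.
  - move=> u; rewrite /deg (_ : [set y | K2 u y] = [set ~~ u]) ?cards1 //.
    by apply/setP=> y; rewrite !inE /K2; case: u; case: y.
  - by rewrite card1.
  - by case: b => - [] [].
have [blkk ptk pair] := bibd; have dual := hadamard_dual t0 bibd.
apply: (@pendant_join_four_eigenvalues R n e _ _ _ (2 * t)) => //.
- by case=> [x|B] [x'|B'].
- by case=> [x|B] [x'|B'] //=; case: side.
- by rewrite muln_gt0.
- case=> [x|B]; rewrite /deg card_sumset /= cards_false.
  + by rewrite add0n ptk.
  + by rewrite addn0 -(blkk B); apply: eq_card => x; rewrite inE.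
- have -> : #|(fun z : 'I_(4 * t - 1) + 'I_(4 * t - 1) =>
      if side then is_inl z else ~~ is_inl z)| = (4 * t - 1)%N.
    transitivity #|[set z : 'I_(4 * t - 1) + 'I_(4 * t - 1) |
        if side then is_inl z else ~~ is_inl z]|.
      by apply: eq_card => z; rewrite inE.
    rewrite card_sumset; case: side => /=;
      by rewrite cards_true cards_false card_ord ?addn0.
  by lia.
(* Pairs of points are counted by the design, pairs of blocks by its dual; mixed pairs have
   different colors, whichever side is joined. *)
case=> [x|B] [x'|B'] neq Pxx'; rewrite card_sumset /=.
- by rewrite cards_false add0n pair // -(inj_eq inl_inj).
- by case: side Pxx'.
- by case: side Pxx'.
- by rewrite cards_false addn0 dual // -(inj_eq inr_inj).
Qed.
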